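(* Let $R$ be a commutative noetherian ring, $\mathfrak a$ an ideal of $R$ and $M$ a coatomic $R$-module. If $H^i_{\mathfrak a}(M)$ is coatomic for all $i\ge r$, where $r\ge 1$, then $H^i_{\mathfrak a}(M)=0$ for all $i\ge r$.
   Context: $H^i_{\mathfrak a}(M)$ denotes the $i$-th local cohomology module of $M$ with respect to $\mathfrak a$. A module is coatomic if each of its proper submodules is contained in a maximal (proper) submodule. *)

(* Defs.v *)
From HB Require Import structures.
From mathcomp Require Import all_boot all_algebra.
From mathcomp Require Import boolp.

Set Implicit Arguments.
Unset Strict Implicit.
Unset Printing Implicit Defensive.

Import GRing.Theory.
Local Open Scope ring_scope.
Local Open Scope quotient_scope.

(* Submodules are boolean predicates [N : submodClosed V], and ideals of [R]  *)
(* are the submodules of [R^o]; the ring_quotient predicate [idealr] is not   *)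
(* used because it only covers proper ideals.  Through classical reflection   *)
(* ([asbool]) boolean predicates amount to arbitrary subsets.                 *)

Definition noetherian_ring (R : comPzRingType) : Prop :=
  forall J : submodClosed R^o, exists s : seq R, forall x : R,
    x \in J <-> exists c : nat -> R, x = \sum_(i < size s) c i * s`_i.

Section Coatomic.
Variables (R : pzRingType) (V : lmodType R).

Definition proper_submod (N : submodClosed V) : Prop := exists x, x \notin N.

Definition maximal_submod (K : submodClosed V) : Prop :=
  proper_submod K /\
  forall L : submodClosed V,
    proper_submod L -> {subset K <= L} -> {subset L <= K}.

Definition coatomic : Prop :=
  forall N : submodClosed V, proper_submod N ->
    exists2 K : submodClosed V, maximal_submod K & {subset N <= K}.

Definition zero_module : Prop := forall x : V, x = 0.

End Coatomic.

Section Submodule.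
Variables (R : pzRingType) (V : lmodType R) (N : submodClosed V).

Record submodule := Submodule { submodule_val : V; _ : submodule_val \in N }.

HB.instance Definition _ := [isSub for submodule_val].
HB.instance Definition _ := [Choice of submodule by <:].
HB.instance Definition _ := [SubChoice_isSubLmodule of submodule by <:].

End Submodule.

(* Adds the scaling to the quotient group of ring_quotient.  That quotient    *)
(* wants a [zmodClosed] predicate, which [submodClosed] does not inherit from *)
(* (it also covers semimodules), hence the copy [submod_zpred] of [N].        *)
Section QuotientModule.
Variables (R : pzRingType) (V : lmodType R) (N : submodClosed V).

Definition submod_zpred : {pred V} := N.

HB.instance Definition _ := GRing.isZmodClosed.Build V submod_zpred
  (GRing.submod_closedB (submodClosedP N)).

Definition quotient_module : Type := Quotient.quot submod_zpred.

HB.instance Definition _ := GRing.Zmodule.on quotient_module.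

Definition quotient_scale (a : R) (q : quotient_module) : quotient_module :=
  \pi_(Quotient.quot submod_zpred) (a *: repr (q : Quotient.quot submod_zpred)).

Fact quotient_scaleE a (v : V) :
  quotient_scale a (\pi_(Quotient.quot submod_zpred) v)
    = \pi_(Quotient.quot submod_zpred) (a *: v).
Proof.
apply/eqP; rewrite -Quotient.idealrBE -scalerBr.
apply: (rpredZ (s := N)); rewrite -[_ \in _]/(_ \in submod_zpred).
by rewrite Quotient.idealrBE reprK.
Qed.

Fact quotient_piP (q : quotient_module) :
  exists v : V, q = \pi_(Quotient.quot submod_zpred) v.
Proof. by exists (repr (q : Quotient.quot submod_zpred)); rewrite reprK. Qed.

Fact quotient_piD (v w : V) :
  \pi_(Quotient.quot submod_zpred) v + \pi_(Quotient.quot submod_zpred) w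
    = \pi_(Quotient.quot submod_zpred) (v + w) :> quotient_module.
Proof. by rewrite -(raddfD \pi_(Quotient.quot submod_zpred)). Qed.

Fact quotient_scaleA a b q :
  quotient_scale a (quotient_scale b q) = quotient_scale (a * b) q.
Proof. by have [v ->] := quotient_piP q; rewrite !quotient_scaleE scalerA. Qed.

Fact quotient_scale1 : left_id 1 quotient_scale.
Proof.
by move=> q; have [v ->] := quotient_piP q; rewrite quotient_scaleE scale1r.
Qed.

Fact quotient_scaleDr : right_distributive quotient_scale +%R.
Proof.
move=> a q1 q2; have [v ->] := quotient_piP q1; have [w ->] := quotient_piP q2.
by rewrite quotient_piD !quotient_scaleE scalerDr quotient_piD.
Qed.

Fact quotient_scaleDl q : {morph quotient_scale^~ q : a b / a + b}.
Proof.
move=> a b; have [v ->] := quotient_piP q.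
by rewrite !quotient_scaleE scalerDl quotient_piD.
Qed.

HB.instance Definition _ := GRing.Zmodule_isLmodule.Build R quotient_module
  quotient_scaleA quotient_scale1 quotient_scaleDr quotient_scaleDl.

End QuotientModule.

Section Torsion.
Variables (R : comPzRingType) (a : submodClosed R^o).

Fixpoint ideal_pow (n : nat) : R -> Prop :=
  if n is m.+1 then
    fun x => exists2 s : seq (R * R),
      forall p, p \in s -> p.1 \in a /\ ideal_pow m p.2 &
      x = \sum_(p <- s) p.1 * p.2
  else fun=> True.

Fact ideal_pow0 n : ideal_pow n 0.
Proof. by case: n => [|n] //=; exists [::] => //; rewrite big_nil. Qed.

Fact ideal_powD n x y : ideal_pow n x -> ideal_pow n y -> ideal_pow n (x + y).
Proof.
case: n => [|n] //= [s Hs ->] [t Ht ->].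
exists (s ++ t); last by rewrite big_cat.
by move=> p; rewrite mem_cat => /orP[/Hs|/Ht].
Qed.

Fact ideal_powZ n r x : ideal_pow n x -> ideal_pow n (r * x).
Proof.
case: n => [|n] //= [s Hs ->]; exists [seq (r * p.1, p.2) | p <- s].
  move=> _ /mapP[p /Hs[p1 p2] ->]; split=> //=.
  by have := @rpredZ R R^o a r _ p1.
by rewrite big_map mulr_sumr; apply: eq_bigr => p _; rewrite mulrA.
Qed.

Fact ideal_pow_le m n x : (m <= n)%N -> ideal_pow n x -> ideal_pow m x.
Proof.
move=> /subnK <-; elim: (n - m)%N x => [|k IH] x //= [s Hs ->].
rewrite big_seq; elim/big_ind: _ => [|u v|p /Hs[_ /IH]].
- exact: ideal_pow0.
- exact: ideal_powD.
- exact: ideal_powZ.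
Qed.

Section TorsionSubmodule.
Variable V : lmodType R.

Definition torsion_pred : {pred V} :=
  [pred v | `[< exists n, forall x, ideal_pow n x -> x *: v = 0 >]].

Fact torsion_submod_closed : submod_closed torsion_pred.
Proof.
split=> [|r v w].
  by apply/asboolP; exists 0%N => x _; rewrite scaler0.
move=> /asboolP[m Hm] /asboolP[n Hn]; apply/asboolP; exists (maxn m n) => x Hx.
rewrite scalerDr scalerA mulrC -scalerA Hm ?scaler0 ?add0r.
  by apply: Hn; apply: ideal_pow_le Hx; rewrite leq_maxr.
by apply: ideal_pow_le Hx; rewrite leq_maxl.
Qed.

HB.instance Definition _ :=
  GRing.isSubmodClosed.Build R V torsion_pred torsion_submod_closed.

Definition torsion : lmodType R := submodule torsion_pred.

End TorsionSubmodule.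

Section TorsionMap.
Variables (V W : lmodType R) (f : {linear V -> W}).

Fact torsion_map_subproof (v : torsion V) : f (val v) \in @torsion_pred W.
Proof.
have /asboolP[n Hn] := valP v; apply/asboolP; exists n => x Hx.
by rewrite -linearZ Hn // linear0.
Qed.

Definition torsion_map (v : torsion V) : torsion W :=
  Submodule (torsion_map_subproof v).

Fact torsion_map_is_linear : linear torsion_map.
Proof. by move=> r u v; apply: val_inj; rewrite /= linearP. Qed.

HB.instance Definition _ :=
  GRing.isLinear.Build R (torsion V) (torsion W) _ torsion_map
    torsion_map_is_linear.

End TorsionMap.

End Torsion.

Arguments torsion_map {R} a {V W} f v.

(* The boundaries are taken inside the kernel, so that the quotient makes     *)
(* sense without a proof that [d i.+1 \o d i] vanishes.                       *)
Section Cohomology.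
Variables (R : pzRingType) (C : nat -> lmodType R).
Variable d : forall i, {linear C i -> C i.+1}.

Definition cocycle_pred (i : nat) : {pred C i} := [pred x | d i x == 0].

Fact cocycle_submod_closed i : submod_closed (@cocycle_pred i).
Proof.
split=> [|r x y]; rewrite !inE ?linear0 // => /eqP dx /eqP dy.
by rewrite linearP dx dy scaler0 addr0.
Qed.

HB.instance Definition _ i :=
  GRing.isSubmodClosed.Build R (C i) (@cocycle_pred i)
    (cocycle_submod_closed i).

Definition cocycle (i : nat) : lmodType R := submodule (@cocycle_pred i).

Definition is_boundary (i : nat) : C i -> Prop :=
  if i is j.+1 then fun x => exists y : C j, d j y = x else fun x => x = 0.

Definition boundary_pred (i : nat) : {pred cocycle i} :=
  [pred x | `[< is_boundary (val x) >]].

Fact boundary_submod_closed i : submod_closed (@boundary_pred i).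
Proof.
split=> [|r x y].
  by apply/asboolP; case: i => [|i] //=; exists 0; rewrite linear0.
move=> /asboolP bx /asboolP bby; apply/asboolP.
case: i x y bx bby => [|i] x y /= => [-> ->|[u <-] [v <-]].
  by rewrite scaler0 addr0.
by exists (r *: u + v); rewrite linearP.
Qed.

HB.instance Definition _ i :=
  GRing.isSubmodClosed.Build R (cocycle i) (@boundary_pred i)
    (boundary_submod_closed i).

Definition cohomology (i : nat) : lmodType R :=
  quotient_module (@boundary_pred i).

End Cohomology.

Definition injective_module (R : pzRingType) (E : lmodType R) : Prop :=
  forall (A B : lmodType R) (f : {linear A -> B}) (g : {linear A -> E}),
    injective f -> exists h : {linear B -> E}, forall x, h (f x) = g x.

Record injective_resolution (R : pzRingType) (M : lmodType R) := {
  resolution_obj : nat -> lmodType R;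
  resolution_diff : forall i, {linear resolution_obj i -> resolution_obj i.+1};
  resolution_aug : {linear M -> resolution_obj 0};
  resolution_injective : forall i, injective_module (resolution_obj i);
  resolution_aug_inj : injective resolution_aug;
  resolution_exact0 : forall x,
    resolution_diff 0 x = 0 <-> exists m, resolution_aug m = x;
  resolution_exact : forall i x,
    resolution_diff i.+1 x = 0 <-> exists y, resolution_diff i y = x
}.

(* Right derived functors of the torsion functor, evaluated on a given        *)
(* injective resolution of [M]; up to isomorphism the choice is immaterial.   *)
Definition local_cohomology (R : comPzRingType) (a : submodClosed R^o)
    (M : lmodType R) (I : injective_resolution M) (i : nat) : lmodType R :=
  cohomology (fun j => torsion_map a (resolution_diff I j)) i.

(* Main.v *)
Require Import Defs.
From HB Require Import structures.
From mathcomp Require Import all_boot all_algebra.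
From mathcomp Require Import boolp.

(** Write [a = (x_1, ..., x_n)] and let [H^i] be the cohomology of the
    [a]-torsion part of an injective resolution.  Two facts hold for every
    module [M].

    First, [H^i = 0] as soon as [i > n].  Torsion with respect to [a] is the
    same as power torsion with respect to each [x_j] ([torsion_tors],
    [tors_torsion]), so the torsion part is reached by imposing one generator
    at a time, and each such step raises the degree above which the cohomology
    vanishes by at most one ([torsion_part_vanish]).

    Secondly, if [s >= 1] and [H^i = 0] for all [i > s], then [H^s = a H^s].
    In derived terms the top cohomology is right exact, so [H^s / a H^s] is the
    cohomology in degree [s] of the Koszul complex of [x_1, ..., x_n] with
    coefficients in the torsion part; the Koszul complex does not see the
    difference between a complex and its torsion part, so this is also the
    cohomology of the Koszul complex with coefficients in the resolution, which
    is zero in positive degrees.  The proof adds generators one at a time: the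
    cone of multiplication by [x] on the [x]-torsion part of an exact complex is
    again exact ([cone_torsion_exact_at]), and a decomposition of cocycles in a
    cone yields one in the complex ([ideal_cocycle_cone]); together they give
    [top_ideal_cocycle].

    Both facts rest on one property of an injective module [E] over a noetherian
    ring: modulo [x]-power torsion, its [b]-torsion part is [x]-divisible
    ([injective_divisible]).

    The theorem follows by descending induction on [i].  When all higher modules
    vanish, [H^i = a H^i].  On the other hand [H^i] is [a]-torsion, so every
    maximal submodule [K] contains [a H^i] ([maximal_torsion]): the simple
    quotient by [K] is killed by [a].  Hence [H^i] has no maximal submodule, and
    a coatomic module without maximal submodules is zero. *)

Set Implicit Arguments.
Unset Strict Implicit.
Unset Printing Implicit Defensive.

Import GRing.Theory.
Local Open Scope ring_scope.

(** * Submodules given by arbitrary predicates, and maps out of quotients *)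

Section PropSubmodule.
Variables (R : pzRingType) (V : lmodType R) (P : V -> Prop).

Definition submod_prop : Prop :=
  P 0 /\ forall (c : R) u v, P u -> P v -> P (c *: u + v).

(** The proof argument makes the closure under linear combinations inferable
    from the predicate, as a canonical instance requires. *)
Definition pred_of_submod of submod_prop : {pred V} := [pred v | `[< P v >]].

Hypothesis subP : submod_prop.

Fact pred_of_submod_closed : submod_closed (pred_of_submod subP).
Proof.
case: (subP) => P0 PD; split=> [|c u v]; first exact/asboolP.
by move=> /asboolP Pu /asboolP Pv; apply/asboolP/PD.
Qed.

HB.instance Definition _ :=
  GRing.isSubmodClosed.Build R V (pred_of_submod subP) pred_of_submod_closed.

Definition submod_of : submodClosed V := pred_of_submod subP.

Lemma submod_ofP v : v \in submod_of <-> P v.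
Proof. by split=> [/asboolP|Pv]; last apply/asboolP. Qed.

Lemma submod_prop0 : P 0. Proof. by case: subP. Qed.

Lemma submod_propD u v : P u -> P v -> P (u + v).
Proof. by case: subP => _ PD Pu Pv; rewrite -[u]scale1r; apply: PD. Qed.

Lemma submod_propZ c u : P u -> P (c *: u).
Proof. by case: subP => P0 PD Pu; rewrite -[_ *: _]addr0; apply: PD. Qed.

Lemma submod_propB u v : P u -> P v -> P (u - v).
Proof.
by move=> Pu Pv; rewrite -scaleN1r; apply/submod_propD/submod_propZ.
Qed.

Lemma submod_prop_sum n (c : nat -> R) (F : nat -> V) :
  (forall i, (i < n)%N -> P (F i)) -> P (\sum_(i < n) c i *: F i).
Proof.
move=> PF; elim/big_ind: _ => [|u v|i _]; first exact: submod_prop0.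
  exact: submod_propD.
exact/submod_propZ/PF.
Qed.

End PropSubmodule.

Lemma submod_prop_eq0 (R : pzRingType) (V : lmodType R) :
  submod_prop (fun v : V => v = 0).
Proof. by split=> // c u v -> ->; rewrite scaler0 addr0. Qed.

Section QuotientLift.
Variables (R : pzRingType) (V W : lmodType R) (N : submodClosed V).
Variables (f : {linear V -> W}) (fN : forall v, v \in N -> f v = 0).

Definition quotient_pi (v : V) : quotient_module N :=
  \pi_(Quotient.quot (submod_zpred N))%qT v.

Fact quotient_pi_linear : linear quotient_pi.
Proof.
move=> c u v; rewrite /quotient_pi -quotient_piD; congr (_ + _).
by symmetry; apply: quotient_scaleE.
Qed.

HB.instance Definition _ :=
  GRing.isLinear.Build R V (quotient_module N) _ quotient_pi quotient_pi_linear.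

Lemma quotient_pi_eq u v : quotient_pi u = quotient_pi v <-> u - v \in N.
Proof.
rewrite -[_ \in N]/(_ \in submod_zpred N) Quotient.idealrBE.
by split=> /eqP.
Qed.

Lemma quotient_lift :
  exists g : {linear quotient_module N -> W},
    forall v, g (quotient_pi v) = f v.
Proof.
pose g (q : quotient_module N) : W :=
  f (repr (q : Quotient.quot (submod_zpred N))).
have g_pi v : g (quotient_pi v) = f v.
  apply/eqP; rewrite -subr_eq0 -linearB; apply/eqP/fN/quotient_pi_eq.
  by rewrite /quotient_pi reprK.
have g_linear : linear g.
  move=> c p q; have [u ->] := quotient_piP p; have [v ->] := quotient_piP q.
  by rewrite -!/(quotient_pi _) -linearP !g_pi linearP.
pose gL : {linear quotient_module N -> W} :=
  HB.pack g (GRing.isLinear.Build R (quotient_module N) W _ g g_linear).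
by exists gL.
Qed.

End QuotientLift.

(** * Torsion with respect to powers of given elements *)

Section PowerTorsion.
Variable R : comPzRingType.

Definition power_torsion (V : lmodType R) (x : R) (v : V) : Prop :=
  exists n, x ^+ n *: v = 0.

(** When [xs] generates an ideal, this is torsion with respect to that ideal.
    The exponent may depend on the element of [xs], so that concatenating lists
    amounts to imposing their conditions one after the other. *)
Definition tors (V : lmodType R) (xs : seq R) (v : V) : Prop :=
  forall x, x \in xs -> power_torsion x v.

Lemma scale_exp_eq0 (V : lmodType R) x m n (v : V) :
  (m <= n)%N -> x ^+ m *: v = 0 -> x ^+ n *: v = 0.
Proof. by move=> /subnK <- xv; rewrite exprD -scalerA xv scaler0. Qed.

Lemma power_torsion_submod (V : lmodType R) x :
  submod_prop (@power_torsion V x).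
Proof.
split=> [|c u v [m xu] [n xv]]; first by exists 0%N; rewrite scaler0.
exists (maxn m n); rewrite scalerDr scalerA mulrC -scalerA.
rewrite (scale_exp_eq0 (leq_maxl m n) xu) (scale_exp_eq0 (leq_maxr m n) xv).
by rewrite scaler0 addr0.
Qed.

Lemma tors_submod (V : lmodType R) xs : submod_prop (@tors V xs).
Proof.
split=> [x _|c u v tu tv x xs_x].
  exact: submod_prop0 (power_torsion_submod V x).
by case: (power_torsion_submod V x) => _; apply; [apply: tu|apply: tv].
Qed.

Lemma power_torsion_map (V W : lmodType R) (f : {linear V -> W}) x v :
  power_torsion x v -> power_torsion x (f v).
Proof. by case=> n xv; exists n; rewrite -linearZ xv linear0. Qed.

Lemma tors_map (V W : lmodType R) (f : {linear V -> W}) xs v :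
  tors xs v -> tors xs (f v).
Proof. by move=> tv x /tv; apply: power_torsion_map. Qed.

Lemma power_torsion_exp (V : lmodType R) x n (v : V) :
  power_torsion x (x ^+ n *: v) -> power_torsion x v.
Proof. by case=> m; rewrite scalerA -exprD; exists (m + n)%N. Qed.

Lemma tors1 (V : lmodType R) x (v : V) : tors [:: x] v <-> power_torsion x v.
Proof.
by split=> [|xv y]; [apply; rewrite mem_head|rewrite inE => /eqP ->].
Qed.

Lemma tors_cat (V : lmodType R) xs ys (v : V) :
  tors (xs ++ ys) v <-> tors xs v /\ tors ys v.
Proof.
split=> [t|[tx ty] x]; last by rewrite mem_cat => /orP[/tx|/ty].
by split=> x xP; apply: t; rewrite mem_cat xP ?orbT.
Qed.

Lemma tors_pair (V W : lmodType R) xs (v : V) (w : W) :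
  tors xs ((v, w) : V * W) <-> tors xs v /\ tors xs w.
Proof.
split=> [t|[tv tw] x xP].
  by split=> x /t[n [xv xw]]; exists n.
have [[m xv] [n xw]] := (tv x xP, tw x xP); exists (maxn m n).
congr pair; first exact: scale_exp_eq0 (leq_maxl m n) xv.
exact: scale_exp_eq0 (leq_maxr m n) xw.
Qed.

End PowerTorsion.

(** * Divisibility of injective modules over a noetherian ring *)

Lemma generator_mem (R : pzRingType) (J : submodClosed R^o) (s : seq R) :
  (forall x, x \in J <->
     exists c : nat -> R, x = \sum_(i < size s) c i * s`_i) ->
  forall i, (i < size s)%N -> s`_i \in J.
Proof.
move=> sP i lt_is; apply/sP.
exists (fun k => (k == i)%:R); rewrite (bigD1 (Ordinal lt_is)) //= eqxx.
rewrite mul1r big1 ?addr0 // => k; rewrite -val_eqE /= => /negPf ->.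
by rewrite mul0r.
Qed.

Lemma uniform_bound n (Q : nat -> nat -> Prop) :
  (forall i k l, (k <= l)%N -> Q i k -> Q i l) ->
  (forall i, (i < n)%N -> exists k, Q i k) ->
  exists k, forall i, (i < n)%N -> Q i k.
Proof.
move=> Q_le; elim: n => [|n IH] H; first by exists 0%N.
have [i /ltnW|k kP] := IH; first exact: H.
have [l lP] := H n (leqnn _); exists (maxn k l) => i.
rewrite ltnS leq_eqVlt => /orP[/eqP ->|/kP].
  exact: Q_le (leq_maxr k l) lP.
exact/Q_le/leq_maxl.
Qed.

Section Noetherian.
Variables (R : comPzRingType) (noethR : noetherian_ring R).

(** The ideals [(C : y^n)] form an increasing chain; a common exponent for
    finitely many generators of its union makes the chain stationary. *)
Lemma colon_stable (C : R^o -> Prop) (y : R) : submod_prop C ->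
  exists j, forall n t, C (y ^+ n *: t) -> C (y ^+ j *: t).
Proof.
move=> subC.
have colon_le m n t : (m <= n)%N -> C (y ^+ m *: t) -> C (y ^+ n *: t).
  by move=> /subnK <- Ct; rewrite exprD -scalerA; apply: submod_propZ.
have subU : submod_prop (fun t : R^o => exists n, C (y ^+ n *: t)).
  split=> [|c u v [m Cu] [n Cv]].
    by exists 0%N; rewrite scaler0; apply: submod_prop0.
  exists (maxn m n); rewrite scalerDr scalerA mulrC -scalerA.
  apply: submod_propD => //; first apply: submod_propZ => //.
    exact: colon_le (leq_maxl m n) Cu.
  exact: colon_le (leq_maxr m n) Cv.
have [s sP] := noethR (submod_of subU).
have [||j jP] := @uniform_bound (size s)
    (fun i n => C (y ^+ n *: (s`_i : R^o))).
- by move=> i m n; apply: colon_le.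
- by move=> i /(generator_mem sP)/(submod_ofP subU).
exists j => n t Ct.
have /sP[c ->] : t \in submod_of subU by apply/submod_ofP; exists n.
rewrite scaler_sumr.
rewrite (eq_bigr (fun i : 'I__ => c i *: (y ^+ j *: (s`_i : R^o)))) => [|i _].
  exact: (submod_prop_sum subC c jP).
exact: mulrCA.
Qed.

(** This replaces the Artin-Rees lemma.  The aim is to solve
    [x^(k+1) e' = x^k e] with [e'] killed by powers of the elements of [b]; as
    [e'] is going to be the image of [1] under a map from [R / C], the ideal [C]
    must contain these powers and yet impose no more on multiples of [x^(k+1)]
    than the annihilator of [x^k e].  The powers are added to [C] one at a time.
    Adding [y^j] is harmless when [y^j e = 0] and [(C : y^j)] is the stable
    value of its chain, since then a multiple of [x^(k+1)] that lies in
    [C + y^j R] is already in [C]. *)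
Lemma torsion_ideal (E : lmodType R) (e : E) (x : R) (b : seq R) :
  tors b e ->
  exists k (C : R^o -> Prop), [/\ submod_prop C,
    forall r : R, C (r * x ^+ k.+1) <-> (r * x ^+ k) *: e = 0 &
    forall y, y \in b -> exists j, C (y ^+ j)].
Proof.
have [k kP] := colon_stable x (submod_prop_eq0 R^o).
(* This k makes the annihilators of powers of x stationary, which settles the
   case where b is empty, with C generated by x^(k+1) ann(x^k e). *)
move=> tb; exists k; elim: b tb => [|y b IH] tb.
  exists (fun u => exists2 d, (d * x ^+ k) *: e = 0 & u = d * x ^+ k.+1).
  split=> [|r|//].
    split=> [|c u v [d dP ->] [d' dP' ->]].
      by exists 0; rewrite !mul0r ?scale0r.
    exists (c * d + d'); last by rewrite mulrDl -mulrA.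
    by rewrite mulrDl scalerDl dP' addr0 -mulrA -scalerA dP scaler0.
  split=> [[d dP /eqP]|?]; last by exists r.
  rewrite -subr_eq0 -mulrBl mulrC => /eqP /kP.
  rewrite -[_ *: _]/(_ * _) mulrC mulrBl => /eqP.
  by rewrite subr_eq0 => /eqP ->.
have [|C [subC CP Cb]] := IH.
  by move=> z zb; apply: tb; rewrite inE zb orbT.
have [n yn] : power_torsion y e by apply: tb; rewrite mem_head.
have [j0 j0P] := colon_stable y subC.
pose j := maxn n j0.
have jP t m : C (y ^+ m *: t) -> C (y ^+ j *: t).
  move=> /j0P Ct; rewrite /j -(subnK (leq_maxr n j0)) exprD -scalerA.
  exact: submod_propZ.
have yj : y ^+ j *: e = 0 by apply: scale_exp_eq0 yn; apply: leq_maxl.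
exists (fun u : R^o => exists t : R^o, C (u - y ^+ j *: t)).
have CC u : C u -> exists t : R^o, C (u - y ^+ j *: t).
  by exists 0; rewrite scaler0 subr0.
split=> [|r|z].
- split=> [|c u v [t Cu] [t' Cv]]; first exact/CC/(submod_prop0 subC).
  exists (c *: t + t').
  suff -> : c *: u + v - y ^+ j *: (c *: t + t') =
      c *: (u - y ^+ j *: t) + (v - y ^+ j *: t').
    by case: subC => _ CD; apply: CD.
  rewrite scalerDr scalerBr opprD addrACA; congr (_ - _ + _).
  by rewrite !scalerA mulrC.
- split=> [[t Ct]|/CP]; last exact: CC.
  have : C (y ^+ j *: (y ^+ j *: t)).
    rewrite -[X in C X](subKr (y ^+ j *: ((r * x ^+ k.+1) : R^o))).
    apply: submod_propB => //; last by rewrite -scalerBr; apply: submod_propZ.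
    rewrite -[_ *: _]/(_ * _) mulrA; apply/CP.
    by rewrite -mulrA mulrC -scalerA yj scaler0.
  rewrite scalerA -exprD => /jP Cyt; apply/CP.
  by rewrite -[X in C X](subrK (y ^+ j *: t)); apply: submod_propD.
rewrite inE => /predU1P[->|/Cb[m Cm]]; last by exists m; apply: CC.
exists j, 1; rewrite -[_ *: _]/(_ * _) mulr1 subrr; exact: submod_prop0.
Qed.

(** Divisibility of the [b]-torsion part of [P] is demanded for all [b] at once,
    because this form is inherited by torsion parts, by concatenating lists. *)
Definition divisible_mod_torsion (V : lmodType R) (P : V -> Prop) : Prop :=
  forall (b : seq R) (x : R) (e : V), P e -> tors b e ->
    exists e', [/\ P e', tors b e' & power_torsion x (e - x *: e')].

(** Multiplication by [x^(k+1)] embeds [R / ann(x^k e)] into [R / C], with [C]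
    as in [torsion_ideal].  The map [R / ann(x^k e) -> E] that sends [1] to
    [x^k e] extends along this embedding, and the image of [1] under the
    extension is the required [e']. *)
Lemma injective_divisible (E : lmodType R) :
  injective_module E -> divisible_mod_torsion (fun _ : E => True).
Proof.
move=> injE b x e _ /(torsion_ideal x)[k [C [subC CP Cb]]].
have subD : submod_prop (fun r : R^o => (r * x ^+ k) *: e = 0).
  split=> [|c u v Hu Hv]; first by rewrite mul0r scale0r.
  rewrite mulrDl scalerDl Hv addr0 -[c *: u]/(c * u).
  by rewrite -mulrA -scalerA Hu scaler0.
pose D := submod_of subD; pose CC := submod_of subC.
pose mulx (r : R^o) : R^o := r * x ^+ k.+1.
have mulx_lin : linear mulx.
  by move=> c u v; rewrite /mulx mulrDl; congr (_ + _); rewrite -[LHS]mulrA.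
pose mulxL : {linear R^o -> R^o} :=
  HB.pack mulx (GRing.isLinear.Build R R^o R^o _ mulx mulx_lin).
pose act (r : R^o) : E := (r * x ^+ k) *: e.
have act_lin : linear act.
  by move=> c u v; rewrite /act mulrDl scalerDl -scalerA; congr (_ + _);
     rewrite !scalerA mulrA.
pose actL : {linear R^o -> E} :=
  HB.pack act (GRing.isLinear.Build R R^o E _ act act_lin).
pose piC : {linear R^o -> quotient_module CC} := @quotient_pi R R^o CC.
have fD r : r \in D -> (piC \o mulxL) r = 0.
  move=> /(submod_ofP subD) Dr; rewrite /= -(linear0 piC).
  by apply/quotient_pi_eq; rewrite subr0; apply/submod_ofP/CP.
have gD r : r \in D -> actL r = 0 by move=> /(submod_ofP subD).
have [f fE] := quotient_lift fD; have [g gE] := quotient_lift gD.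
have f_inj : injective f.
  move=> p q; have [u ->] := quotient_piP p; have [v ->] := quotient_piP q.
  rewrite -!/(quotient_pi _ _) !fE => /quotient_pi_eq /(submod_ofP subC) Cuv.
  apply/quotient_pi_eq/submod_ofP/CP.
  by move: Cuv; rewrite /mulxL /= /mulx -mulrBl.
have [h hf] := injE _ _ f g f_inj.
pose e' := h (piC 1).
have he (r : R) : h (piC r) = r *: e'.
  by rewrite -linearZ -linearZ; congr (h (piC _)); rewrite -[RHS]/(r * 1) mulr1.
exists e'; split=> // [y /Cb[j Cyj]|].
  exists j; rewrite -he -(linear0 h); congr (h _); rewrite -(linear0 piC).
  by apply/quotient_pi_eq; rewrite subr0; apply/submod_ofP.
exists k; rewrite scalerBr scalerA -exprSr -he.
have := hf (quotient_pi D 1); rewrite fE gE /= /mulx /act !mul1r => ->.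
exact: subrr.
Qed.

End Noetherian.

(** * Torsion parts and cones of complexes *)

Section Complexes.
Variable R : comPzRingType.

Record complex := Complex {
  term : nat -> lmodType R;
  diff : forall i, {linear term i -> term i.+1};
  diffK : forall i v, diff i.+1 (diff i v) = 0
}.

(** Subcomplexes are kept as predicates on a fixed complex, so that a torsion
    part of a torsion part, or of a cone, still lives on the same modules. *)
Definition family (K : complex) := forall i, term K i -> Prop.

Definition subcomplex (K : complex) (P : family K) : Prop :=
  (forall i, submod_prop (P i)) /\ (forall i v, P i v -> P i.+1 (diff K i v)).

(** Exactness in degree [i.+1]: degree [0] is left out because the torsion part
    of a resolution need not be exact there. *)
Definition exact_at (K : complex) (P : family K) (i : nat) : Prop :=
  forall z, P i.+1 z -> diff K i.+1 z = 0 -> exists2 y, P i y & diff K i y = z.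

Definition torsion_part (K : complex) (xs : seq R) (P : family K) : family K :=
  fun i v => P i v /\ tors xs v.

Arguments torsion_part {K} xs P i v.

Definition divisible (K : complex) (P : family K) : Prop :=
  forall i, divisible_mod_torsion (P i).

Lemma torsion_part_subcomplex K xs (P : family K) :
  subcomplex P -> subcomplex (torsion_part xs P).
Proof.
case=> subP dP; split=> i => [|v [Pv tv]].
  have tS := tors_submod (term K i) xs.
  split=> [|c u v [Pu tu] [Pv tv]].
    by split; [exact: submod_prop0 (subP i)|exact: submod_prop0 tS].
  by split; [case: (subP i) => _; apply|case: tS => _; apply].
by split; [exact: dP|exact: tors_map].
Qed.

Lemma torsion_part_cat K xs ys (P : family K) :
  torsion_part ys (torsion_part xs P) = torsion_part (xs ++ ys) P.
Proof.
apply: functional_extensionality_dep => i; apply/funext => v; apply/propext.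
split=> [[[Pv tx] ty]|[Pv /tors_cat[tx ty]]]; last by [].
by split=> //; apply/tors_cat.
Qed.

Lemma torsion_part_nil K (P : family K) : torsion_part [::] P = P.
Proof.
apply: functional_extensionality_dep => i; apply/funext => v; apply/propext.
by split=> [[]|].
Qed.

Lemma torsion_part_divisible K xs (P : family K) :
  divisible P -> divisible (torsion_part xs P).
Proof.
move=> divP i b x e [Pe te] tbe.
have [|e' [Pe' /tors_cat[te' tbe'] xe]] := divP i (xs ++ b) x e Pe.
  exact/tors_cat.
by exists e'.
Qed.

(** Given a cocycle [z] with [x^m z = 0], write [z = d y] in [P].  Then [x^m y]
    is a cocycle, hence [d w] for some [w].  Divisibility gives [w'] such that
    [w - x^m w'] is [x]-torsion, and [y - d w'] is an [x]-torsion primitive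
    of [z]. *)
Lemma torsion_part_exact_at K x (P : family K) n :
  subcomplex P -> divisible P -> exact_at P n -> exact_at P n.+1 ->
  exact_at (torsion_part [:: x] P) n.+1.
Proof.
move=> [subP dP] divP ex_n ex_n1 z [Pz /tors1 [m xz]] dz.
have [y Py dy] := ex_n1 z Pz dz.
have [w Pw dw] : exists2 w, P n w & diff K n w = x ^+ m *: y.
  by apply: ex_n; [exact: submod_propZ|rewrite linearZ dy].
have w_div : forall m, exists2 w', P n w' & power_torsion x (w - x ^+ m *: w').
  elim=> [|j [w1 Pw1 tw1]].
    exists w => //; rewrite scale1r subrr.
    exact: submod_prop0 (power_torsion_submod _ x).
  have [|w2 [Pw2 _ tw2]] := divP n [::] x w1 Pw1; first by [].
  exists w2 => //.
  have -> : w - x ^+ j.+1 *: w2 = (w - x ^+ j *: w1) + x ^+ j *: (w1 - x *: w2).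
    by rewrite scalerBr scalerA -exprSr addrA subrK.
  apply: (submod_propD (power_torsion_submod _ x) tw1).
  exact: (submod_propZ (power_torsion_submod _ x)).
have [w' Pw' tw'] := w_div m.
exists (y - diff K n w'); last by rewrite linearB diffK subr0.
split; first by apply: submod_propB => //; exact: dP.
apply/tors1/(@power_torsion_exp _ _ _ m).
by rewrite scalerBr -dw -linearZ -linearB; apply: power_torsion_map.
Qed.

Lemma torsion_part_vanish K xs (P : family K) n :
  subcomplex P -> divisible P -> (forall i, (n <= i)%N -> exact_at P i) ->
  forall i, (n + size xs <= i)%N -> exact_at (torsion_part xs P) i.
Proof.
elim: xs P n => [|x xs IH] P n subP divP exP i.
  by rewrite addn0 torsion_part_nil; apply: exP.
rewrite /= addnS -addSn -[x :: xs]/([:: x] ++ xs) -torsion_part_cat.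
apply: IH i; [exact: torsion_part_subcomplex|exact: torsion_part_divisible|].
case=> // i le_ni; apply: torsion_part_exact_at => //; apply: exP => //.
exact: leqW.
Qed.

(** The cone of multiplication by [x] is the Koszul complex of [x] with
    coefficients in [K], in degrees [-1] and [0]. *)
Section Cone.
Variables (x : R) (K : complex).

Definition cone_term (i : nat) : lmodType R := (term K i * term K i.+1)%type.

Definition cone_diff i (p : cone_term i) : cone_term i.+1 :=
  (diff K i p.1 + x *: p.2, - diff K i.+1 p.2).

Fact cone_diff_linear i : linear (@cone_diff i).
Proof.
move=> c p q; rewrite /cone_diff /= !linearP; congr pair => /=.
by rewrite scalerDr addrACA.
Qed.

HB.instance Definition _ i :=
  GRing.isLinear.Build R (cone_term i) (cone_term i.+1) _ (@cone_diff i)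
    (@cone_diff_linear i).

Fact cone_diffK i p : @cone_diff i.+1 (@cone_diff i p) = 0.
Proof.
rewrite /cone_diff /= linearD linearN linearZ !diffK; congr pair => /=.
  by rewrite add0r subrr.
by rewrite linearN diffK !oppr0.
Qed.

Definition cone : complex := Complex cone_diffK.

Definition cone_family (P : family K) : family cone :=
  fun i p => P i p.1 /\ P i.+1 p.2.

End Cone.

Arguments cone_family x {K} P i p.

Lemma cone_family_subcomplex x K (P : family K) :
  subcomplex P -> subcomplex (cone_family x P).
Proof.
case=> subP dP; split=> i => [|[u v] [/= Pu Pv]].
  split=> [|c [u v] [u' v'] [/= Pu Pv] [/= Pu' Pv']].
    by split; exact: submod_prop0.
  by split=> /=; apply: submod_propD => //; apply: submod_propZ.
split=> /=; last by rewrite -scaleN1r; apply: submod_propZ => //; apply: dP.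
by apply: submod_propD => //; [apply: dP|apply: submod_propZ].
Qed.

Lemma torsion_part_cone x K xs (P : family K) :
  torsion_part xs (cone_family x P) = cone_family x (torsion_part xs P).
Proof.
apply: functional_extensionality_dep => i.
apply/funext => -[u v]; apply/propext.
split=> [[[Pu Pv] /tors_pair[tu tv]]|[[Pu tu] [Pv tv]]]; first by [].
by split=> //; apply/tors_pair.
Qed.

Lemma cone_divisible x K (P : family K) :
  divisible P -> divisible (cone_family x P).
Proof.
move=> divP i b y [u v] [/= Pu Pv] /tors_pair[tu tv].
have [u' [Pu' tu' yu]] := divP i b y u Pu tu.
have [v' [Pv' tv' yv]] := divP i.+1 b y v Pv tv.
exists (u', v'); split=> //; first exact/tors_pair.
by apply/tors1/tors_pair; split; apply/tors1.
Qed.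

Lemma cone_exact_at x K (P : family K) n :
  subcomplex P -> exact_at P n -> exact_at P n.+1 ->
  exact_at (cone_family x P) n.
Proof.
move=> [subP dP] ex_n ex_n1 [u v] [/= Pu Pv] [].
rewrite /= => du /eqP; rewrite oppr_eq0 => /eqP dv.
have [w Pw dw] := ex_n1 v Pv dv.
have [||p Pp dp] := ex_n (u + x *: w).
- by apply: submod_propD => //; apply: submod_propZ.
- by rewrite linearD linearZ dw.
exists (p, - w).
  by split=> //=; rewrite -scaleN1r; apply: submod_propZ.
by congr pair => /=; rewrite linearN ?opprK // dp addrK.
Qed.

(** Divisibility makes [x] bijective on [P] modulo its [x]-torsion part, so
    the cone of [x] on that quotient is exact and the two cones have the same
    cohomology.  Concretely, let [(u, v)] be a cocycle.  Write [v = d w] and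
    [u + x w = d p] in [P], then [p = x q + t] with [t] in the torsion part;
    the primitive is [(t, d q - w)], whose second entry is [x]-torsion because
    [x (d q - w) = u - d t] is. *)
Lemma cone_torsion_exact_at x K (P : family K) :
  subcomplex P -> divisible P -> (forall i, exact_at P i) ->
  forall i, exact_at (cone_family x (torsion_part [:: x] P)) i.
Proof.
move=> [subP dP] divP exP i [u v] [[/= Pu /tors1 tu] [/= Pv /tors1 tv]] [].
rewrite /= => du /eqP; rewrite oppr_eq0 => /eqP dv.
have [w Pw dw] := exP _ v Pv dv.
have [||p Pp dp] := exP i (u + x *: w).
- by apply: submod_propD => //; apply: submod_propZ.
- by rewrite linearD linearZ dw.
have [|q [Pq _ tq]] := divP i [::] x p Pp; first by [].
pose t := p - x *: q; pose v' := diff K i q - w.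
have uE : u = diff K i t + x *: v'.
  by rewrite /t /v' linearB linearZ scalerBr dp addrA subrK addrK.
have Pt : P i t by apply: submod_propB => //; apply: submod_propZ.
have Pv' : P i.+1 v' by apply: submod_propB => //; apply: dP.
exists (t, v'); last first.
  by congr pair => //=; rewrite /v' linearB diffK sub0r opprK.
split; split=> //; apply/tors1 => //; apply: (@power_torsion_exp _ _ _ 1).
rewrite expr1; have -> : x *: v' = u - diff K i t by rewrite uE addrC addKr.
apply: (submod_propB (power_torsion_submod _ x) tu); exact: power_torsion_map.
Qed.

(** The class of [z] lies in [x_1 H + ... + x_n H], where [H] is the cohomology
    of [P] in degree [i.+1] and [xs = x_1, ..., x_n].  Peeling off one element
    of [xs] at a time avoids sums of cocycles. *)
Fixpoint ideal_cocycle (K : complex) (P : family K) i (xs : seq R)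
    (z : term K i.+1) : Prop :=
  if xs is x :: ys then
    exists c, [/\ P i.+1 c, diff K i.+1 c = 0 &
                  ideal_cocycle P ys (z - x *: c)]
  else exists2 y, P i y & diff K i y = z.

(** If the cohomology [H] of [P] vanishes one degree higher, the cohomology of
    the cone is [H / x H], where the class of a cocycle [(u, d w)] is that of
    [u + x w]; a class in [(ys) (H / x H)] lifts to one in [(x, ys) H].  The
    primitive [w] is left arbitrary for the induction on [ys], which changes
    it. *)
Lemma ideal_cocycle_cone x K (P : family K) i ys :
  subcomplex P -> exact_at P i.+1 ->
  forall p, ideal_cocycle (cone_family x P) (i := i) ys p ->
  forall w, P i.+1 w -> diff K i.+1 w = p.2 ->
  ideal_cocycle P (x :: ys) (p.1 + x *: w).
Proof.
move=> [subP dP] exP; elim: ys => [|y ys IH] [u v] /=.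
  case=> -[p q] [/= Pp Pq] [<- <-] w Pw dw; exists (q + w); split.
  - exact: submod_propD.
  - by rewrite linearD dw subrr.
  - by exists p => //=; rewrite scalerDr -[X in _ = X - _]addrA addrK.
case=> -[u' v'] [[/= Pu' Pv'] [du' /eqP]].
rewrite oppr_eq0 => /eqP dv' idc w Pw dw.
have [w' Pw' dw'] := exP v' Pv' dv'.
have [||c [Pc dc idc']] := IH _ idc (w - y *: w').
- by apply: submod_propB => //; apply: submod_propZ.
- by rewrite linearB linearZ dw dw'.
exists c; split=> //; exists (u' + x *: w'); split.
- by apply: submod_propD => //; apply: submod_propZ.
- by rewrite linearD linearZ dw'.
suff -> : u + x *: w - x *: c - y *: (u' + x *: w') =
    u - y *: u' + x *: (w - y *: w') - x *: c by [].
rewrite [in RHS]scalerBr scalerDr !scalerA [y * x]mulrC opprD.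
by rewrite [LHS]addrAC; congr (_ - _); rewrite addrACA.
Qed.

(** The induction on [xs] replaces [P] by the cone of [x] on its [x]-torsion
    part.  That cone is still exact and divisible, and its torsion part, being
    the cone of the torsion part, keeps vanishing above degree [s.+1]. *)
Lemma top_ideal_cocycle xs K (P : family K) s :
  subcomplex P -> divisible P -> (forall i, exact_at P i) ->
  (forall i, (s < i)%N -> exact_at (torsion_part xs P) i) ->
  forall z, torsion_part xs P s.+1 z -> diff K s.+1 z = 0 ->
  ideal_cocycle (torsion_part xs P) xs z.
Proof.
elim: xs K P => [|x xs IH] K P subP divP exP exT z Tz dz.
  by rewrite torsion_part_nil; apply: exP => //; case: Tz.
have TE : torsion_part xs (cone_family x (torsion_part [:: x] P)) =
          cone_family x (torsion_part (x :: xs) P).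
  by rewrite torsion_part_cone torsion_part_cat.
have subT := torsion_part_subcomplex (x :: xs) subP.
have subT1 := torsion_part_subcomplex [:: x] subP.
have T0 i : torsion_part (x :: xs) P i 0.
  by case: subT => subT _; apply: submod_prop0.
have := IH (cone x K) (cone_family x (torsion_part [:: x] P)).
rewrite TE => /(_ _ _ _ _ (z, 0)) IHz.
have {}IHz : ideal_cocycle (cone_family x (torsion_part (x :: xs) P)) xs
    ((z, 0) : term (cone x K) s.+1).
  apply: IHz.
  - exact: cone_family_subcomplex.
  - exact/cone_divisible/torsion_part_divisible.
  - exact: cone_torsion_exact_at.
  - move=> i lt_si; apply: cone_exact_at => //; apply: exT => //.
    exact: leqW.
  - by split=> /=; last exact: T0.
  - by congr pair => /=; rewrite !linear0 ?dz ?addr0.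
have := ideal_cocycle_cone subT (exT _ (ltnSn s)) IHz (T0 _) (linear0 _).
by rewrite scaler0 addr0.
Qed.

End Complexes.

Arguments torsion_part {R K} xs P i v.

(** * Ideal torsion in terms of generators *)

Section Torsion.
Variables (R : comPzRingType) (a : submodClosed R^o) (s : seq R).
Hypothesis sP : forall x : R,
  x \in a <-> exists c : nat -> R, x = \sum_(i < size s) c i * s`_i.

Lemma torsion_tors (V : lmodType R) (v : V) :
  v \in @torsion_pred R a V -> tors s v.
Proof.
move=> /asboolP[n nP] _ /(nthP 0)[i /(generator_mem sP) ax <-].
exists n; apply: nP; move: s`_i ax => x ax.
elim: n => [|n IH] //=; exists [:: (x, x ^+ n)].
  by move=> p; rewrite inE => /eqP ->.
by rewrite big_seq1 exprS.
Qed.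

Lemma torsion_generators (V : lmodType R) (v : V) :
  (forall x, x \in s -> x *: v \in @torsion_pred R a V) ->
  v \in @torsion_pred R a V.
Proof.
move=> sv.
have [] := @uniform_bound (size s)
  (fun i n => forall x, ideal_pow a n x -> x *: (s`_i *: v) = 0).
- by move=> i m n le_mn H x /(ideal_pow_le le_mn); apply: H.
- by move=> i lt_is; have /asboolP := sv _ (mem_nth 0 lt_is).
move=> n nP; apply/asboolP; exists n.+1 => _ [t tP ->].
rewrite big_seq scaler_suml big1 // => p /tP[/sP[c ->] pn].
rewrite mulr_suml scaler_suml big1 // => i _.
by rewrite -mulrA [s`_i * _]mulrC -!scalerA nP ?scaler0 // ltn_ord.
Qed.

(** The elements of [l] are moved one at a time to [r], the list of those whose
    multiples of [v] are already known to be [a]-torsion; an induction on the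
    exponent [n] with [x^n v = 0] justifies moving [x].  Once every generator is
    in [r], [torsion_generators] applies. *)
Lemma tors_torsion (V : lmodType R) (v : V) :
  tors s v -> v \in @torsion_pred R a V.
Proof.
have H (l r : seq R) : (forall y, y \in s -> y \in l \/ y \in r) ->
    forall v : V, tors l v ->
    (forall y, y \in r -> y *: v \in @torsion_pred R a V) ->
    v \in @torsion_pred R a V.
  elim: l r => [|x l IHl] r slr {}v tv rv.
    by apply: torsion_generators => y /slr[//|]; apply: rv.
  have [n] : power_torsion x v by apply: tv; rewrite mem_head.
  elim: n v tv rv => [|n IHn] v tv rv.
    by rewrite scale1r => ->; apply: rpred0.
  rewrite exprSr -scalerA => xv.
  have xT : x *: v \in @torsion_pred R a V.
    apply: IHn xv => [|y yr].
      exact: (submod_propZ (tors_submod V (x :: l))).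
    by rewrite scalerA mulrC -scalerA; apply: rpredZ; apply: rv.
  apply: (IHl (x :: r)) => [y /slr|y yl|y].
  - by rewrite !inE => -[/orP[->|->]|->]; rewrite ?orbT; [right|left|right].
  - by apply: tv; rewrite inE yl orbT.
  - by rewrite inE => /predU1P[->|/rv].
by move=> tv; apply: (H s [::]) => // y; left.
Qed.

End Torsion.

(** * Coatomic local cohomology modules *)

(** If [x v] were not in [K], maximality would give [v = r x v] modulo [K] for
    some [r]; iterating, [v = (r x)^n v] modulo [K], which is zero for large
    [n]. *)
Lemma maximal_torsion (R : comPzRingType) (V : lmodType R) (K : submodClosed V)
    (x : R) :
  maximal_submod K -> (forall v : V, power_torsion x v) ->
  forall v, x *: v \in K.
Proof.
move=> [_ maxK] tV v; apply: contrapT => /negP xvK.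
have subL : submod_prop (fun u : V => exists r, u - r *: (x *: v) \in K).
  split=> [|c u w [r Ku] [t Kw]].
    by exists 0; rewrite scale0r subr0 rpred0.
  exists (c * r + t).
  have -> : c *: u + w - (c * r + t) *: (x *: v) =
      c *: (u - r *: (x *: v)) + (w - t *: (x *: v)).
    by rewrite scalerDl -scalerA scalerBr opprD addrACA.
  by apply: rpredD => //; apply: rpredZ.
have [properL|] := pselect (proper_submod (submod_of subL)).
  case/negP: xvK; apply: (maxK _ properL) => [u Ku|]; apply/submod_ofP.
    by exists 0; rewrite scale0r subr0.
  by exists 1; rewrite scale1r subrr rpred0.
move=> /forallNP /(_ v) /negP; rewrite negbK => /submod_ofP[r Kv].
have Kn n : v - (r * x) ^+ n *: v \in K.
  elim: n => [|n IH]; first by rewrite scale1r subrr rpred0.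
  have -> : v - (r * x) ^+ n.+1 *: v =
      (v - (r * x) ^+ n *: v) + (r * x) ^+ n *: (v - r *: (x *: v)).
    by rewrite scalerBr !scalerA -exprSr addrA subrK.
  by apply: rpredD => //; apply: rpredZ.
have [n xv] := tV v.
have := Kn n; rewrite exprMn -scalerA xv scaler0 subr0 => vK.
by case/negP: xvK; apply: rpredZ.
Qed.

Section LocalCohomology.
Variables (R : comPzRingType) (noethR : noetherian_ring R).
Variables (a : submodClosed R^o) (s : seq R).
Hypothesis sP : forall x : R,
  x \in a <-> exists c : nat -> R, x = \sum_(i < size s) c i * s`_i.
Variables (M : lmodType R) (I : injective_resolution M).

Definition resolution_complex : complex R :=
  @Complex R (resolution_obj I) (resolution_diff I)
    (fun i v => (resolution_exact (resolution_diff I i v)).2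
                  (ex_intro _ v erefl)).

Definition whole : family resolution_complex := fun _ _ => True.

Lemma whole_subcomplex : subcomplex whole. Proof. by []. Qed.

Lemma whole_divisible : divisible whole.
Proof.
move=> i; apply: (injective_divisible noethR).
exact: (resolution_injective (i := i)).
Qed.

Lemma whole_exact_at i : exact_at whole i.
Proof. by move=> z _ /resolution_exact[y dy]; exists y. Qed.

Definition torsion_diff j :
    {linear torsion a (resolution_obj I j) ->
            torsion a (resolution_obj I j.+1)} :=
  torsion_map a (resolution_diff I j).

Lemma torsion_part_val i (v : torsion a (resolution_obj I i)) :
  torsion_part s whole i (val v).
Proof. by split=> //; apply: torsion_tors (valP v). Qed.

Lemma torsion_lift i (z : resolution_obj I i) : torsion_part s whole i z ->
  exists v : torsion a (resolution_obj I i), val v = z.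
Proof. by case=> _ /(tors_torsion sP) tz; exists (Submodule tz). Qed.

Lemma cocycle_diff i (v : cocycle torsion_diff i) :
  resolution_diff I i (val (val v)) = 0.
Proof. by have /eqP/(congr1 val) := valP v. Qed.

Lemma cocycle_lift i z : torsion_part s whole i z ->
  diff resolution_complex i z = 0 ->
  exists v : cocycle torsion_diff i, val (val v) = z.
Proof.
move=> /torsion_lift[v <-] dv.
have zv : v \in cocycle_pred torsion_diff (i := i) by apply/eqP/val_inj.
by exists (Submodule zv).
Qed.

Definition cohomology_class i (v : cocycle torsion_diff i) :
    local_cohomology a I i :=
  quotient_pi (boundary_pred (d := torsion_diff) (i := i)) v.

Lemma cohomology_class_eq0 i (v : cocycle torsion_diff i.+1) :
  cohomology_class v = 0 <->
  exists2 y, torsion_part s whole i y & resolution_diff I i y = val (val v).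
Proof.
rewrite /cohomology_class -(linear0 (quotient_pi _)).
split=> [/quotient_pi_eq|[y /torsion_lift[u <-] dy]].
  rewrite subr0 => /asboolP /= [u du].
  exists (val u); [exact: torsion_part_val|by rewrite -du].
apply/quotient_pi_eq; rewrite subr0; apply/asboolP; exists u.
exact: val_inj.
Qed.

Lemma cohomology_class_surj i (h : local_cohomology a I i) :
  exists v, h = cohomology_class v.
Proof. exact: quotient_piP. Qed.

Lemma local_cohomology_eq0 i :
  zero_module (local_cohomology a I i.+1) <-> exact_at (torsion_part s whole) i.
Proof.
split=> [H0 z /cocycle_lift/[apply] -[v <-]|ex h].
  by have /cohomology_class_eq0 := H0 (cohomology_class v).
have [v ->] := cohomology_class_surj h; apply/cohomology_class_eq0.
by apply: ex; [exact: torsion_part_val|exact: cocycle_diff].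
Qed.

Lemma local_cohomology_torsion i x (h : local_cohomology a I i) :
  x \in s -> power_torsion x h.
Proof.
move=> xs; have [v ->] := cohomology_class_surj h.
have [n xv] := torsion_tors sP (valP (val v)) xs.
exists n; rewrite /cohomology_class -linearZ -(linear0 (quotient_pi _)).
congr (quotient_pi _ _).
exact/val_inj/val_inj.
Qed.

Lemma ideal_cocycle_maximal i (K : submodClosed (local_cohomology a I i.+1)) xs
    (v : cocycle torsion_diff i.+1) :
  maximal_submod K -> {subset xs <= s} ->
  @ideal_cocycle R resolution_complex (torsion_part s whole) i xs
    (val (val v)) ->
  cohomology_class v \in K.
Proof.
move=> maxK; elim: xs v => [|x xs IH] v xs_s /=.
  by move=> /cohomology_class_eq0 ->; apply: rpred0.
case=> c [/cocycle_lift/[apply] -[u <-] idv].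
have -> : cohomology_class v =
    cohomology_class (v - x *: u) + x *: cohomology_class u.
  by rewrite /cohomology_class -linearZ -linearD subrK.
apply: rpredD.
  by apply: IH => // y yxs; apply: xs_s; rewrite inE yxs orbT.
apply: maximal_torsion => // h; apply: local_cohomology_torsion.
by rewrite xs_s ?mem_head.
Qed.

(** Every class lies in every maximal submodule, so there is none; applied to
    the zero submodule, coatomicity then forces the module to be zero. *)
Lemma coatomic_top_eq0 i :
  (forall j, (i < j)%N -> zero_module (local_cohomology a I j.+1)) ->
  coatomic (local_cohomology a I i.+1) ->
  zero_module (local_cohomology a I i.+1).
Proof.
move=> H0 coatH h; apply: contrapT => /eqP h0.
have sub0 := submod_prop_eq0 (local_cohomology a I i.+1).
have [|K maxK _] := coatH (submod_of sub0).
  by exists h; apply/negP => /(submod_ofP sub0)/eqP; apply/negP.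
have [[k /negP kK] _] := maxK; apply: kK.
have [v ->] := cohomology_class_surj k.
apply: (ideal_cocycle_maximal maxK (xs := s)) => //.
apply: top_ideal_cocycle; [exact: whole_subcomplex|exact: whole_divisible
  |exact: whole_exact_at| |exact: torsion_part_val|exact: cocycle_diff].
by move=> j /H0/local_cohomology_eq0.
Qed.

Lemma local_cohomology_vanish i :
  (size s <= i)%N -> zero_module (local_cohomology a I i.+1).
Proof.
move=> le_si; apply/local_cohomology_eq0.
apply: (torsion_part_vanish (n := 0)) => //; first exact: whole_divisible.
by move=> j _; apply: whole_exact_at.
Qed.

End LocalCohomology.

Theorem corollary3p10 (R : comPzRingType) (noethR : noetherian_ring R)
    (a : submodClosed R^o) (M : lmodType R) (coatM : coatomic M)
    (I : injective_resolution M) (r : nat) (r_ge1 : (1 <= r)%N)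
    (coatH : forall i : nat, (r <= i)%N -> coatomic (local_cohomology a I i)) :
  forall i : nat, (r <= i)%N -> zero_module (local_cohomology a I i).
Proof.
have [s sP] := noethR a.
have H0 n i : (r <= i.+1)%N -> (size s <= i + n)%N ->
    zero_module (local_cohomology a I i.+1).
  elim: n i => [|n IH] i le_ri.
    by rewrite addn0; apply: local_cohomology_vanish.
  rewrite addnS -addSn => le_si.
  apply: (coatomic_top_eq0 noethR sP); last first.
    exact: coatH.
  move=> j lt_ij; apply: IH; first exact: leq_trans le_ri (leqW lt_ij).
  by apply: leq_trans le_si _; rewrite leq_add2r.
case=> [|i] le_ri; first by move: le_ri; rewrite leqNgt r_ge1.
by apply: (H0 (size s)) => //; apply: leq_addl.
Qed.
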